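(* Let $\mathbb K$ be an algebraically closed field of characteristic zero. Let $V$ be the $\mathbb K[x,y]$-module with $\mathbb K$-basis $v_1,v_2,a_1,a_2$ and let $W$ be the $\mathbb K[x,y]$-module with $\mathbb K$-basis $w_1,w_2,b_1,b_2$, with the following actions of $x$ and $y$: (i) $xv_1=a_1$, $xv_2=a_2$, and the other products of $x,y$ and the basis elements of $V$ are zero; (ii) $xw_1=b_1$, $yw_1=b_2$, and the other products of $x,y$ and the basis elements of $W$ are zero. Then the $\mathbb K[x,y]$-modules $V$ and $W$ are not weakly isomorphic, but the corresponding associated Lie algebras $L_V$ and $L_W$ are isomorphic.
   Context: Associated Lie algebra: for a $\mathbb K[x,y]$-module $V$, let $P,Q$ be the commuting linear operators $P(v)=x\cdot v$, $Q(v)=y\cdot v$ on $V$. The Lie algebra $L_V=\mathbb K\langle P,Q\rangle\rightthreetimes V$ associated with $V$ is the external semidirect product of the two-dimensional abelian Lie algebra with basis $P,Q$ (always two-dimensional, even if $P,Q$ are linearly dependent as operators, e.g. if $Q=0$) and the abelian Lie algebra $V$: as a vector space it is $\mathbb K\langle P,Q\rangle\oplus V$, with bracket $[P,Q]=0$, $[v,v']=0$, $[P,v]=P(v)$, $[Q,v]=Q(v)$ for $v,v'\in V$. $L_W$ is defined in the same way from $W$. Weak isomorphism: a linear automorphism $\theta$ of $\mathbb K[x,y]$ is a $\mathbb K$-algebra automorphism of the form $\theta(x)=\alpha_{11}x+\alpha_{12}y$, $\theta(y)=\alpha_{21}x+\alpha_{22}y$ with $[\alpha_{ij}]$ a nonsingular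 matrix over $\mathbb K$. The twisted module $V_\theta$ is the vector space $V$ with the action $x\circ v=\theta(x)\cdot v$, $y\circ v=\theta(y)\cdot v$. Modules $V$ and $W$ are weakly isomorphic if there is a finite sequence of $\mathbb K[x,y]$-modules $V_1=V,V_2,\dots,V_k=W$ such that for each $i=1,\dots,k-1$ either $V_i\simeq V_{i+1}$ or $V_{i+1}=(V_i)_{\theta_i}$ for some linear automorphism $\theta_i$. *)

(* Defs.v *)
From HB Require Import structures.
From mathcomp Require Import all_boot all_order all_algebra.
From mathcomp Require Import mpoly.

Set Implicit Arguments.
Unset Strict Implicit.
Unset Printing Implicit Defensive.

Import GRing.Theory.
Local Open Scope ring_scope.

Notation Kxy K := {mpoly K[2]}.

Definition px (K : fieldType) : Kxy K := 'X_(0 : 'I_2).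
Definition py (K : fieldType) : Kxy K := 'X_(1 : 'I_2).

(* Restriction of scalars along K -> K[x,y]: the K-vector space underlying V. *)
Section UnderlyingSpace.
Variables (K : fieldType) (V : lmodType (Kxy K)).

Definition Kspace : Type := V.

HB.instance Definition _ := GRing.Zmodule.copy Kspace V.

Definition Kscale (c : K) (v : Kspace) : Kspace := (c%:MP : Kxy K) *: (v : V).

Fact KscaleA (c d : K) (v : Kspace) : Kscale c (Kscale d v) = Kscale (c * d) v.
Proof. by rewrite /Kscale scalerA mpolyCM. Qed.

Fact Kscale1 : left_id 1 Kscale.
Proof. by move=> v; rewrite /Kscale mpolyC1 scale1r. Qed.

Fact KscaleDr : right_distributive Kscale +%R.
Proof. by move=> c u v; rewrite /Kscale scalerDr. Qed.

Fact KscaleDl (v : Kspace) : {morph Kscale^~ v : c d / c + d}.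
Proof. by move=> c d; rewrite /Kscale mpolyCD scalerDl. Qed.

HB.instance Definition _ := GRing.Zmodule_isLmodule.Build K Kspace
  KscaleA Kscale1 KscaleDr KscaleDl.

Definition opP (v : Kspace) : Kspace := px K *: (v : V).
Definition opQ (v : Kspace) : Kspace := py K *: (v : V).

Fact opP_is_linear : linear opP.
Proof.
by move=> c u v; rewrite /opP scalerDr [_ *: (c *: u : V)]scalerA mulrC -scalerA.
Qed.

Fact opQ_is_linear : linear opQ.
Proof.
by move=> c u v; rewrite /opQ scalerDr [_ *: (c *: u : V)]scalerA mulrC -scalerA.
Qed.

HB.instance Definition _ :=
  GRing.isLinear.Build K Kspace Kspace *:%R opP opP_is_linear.
HB.instance Definition _ :=
  GRing.isLinear.Build K Kspace Kspace *:%R opQ opQ_is_linear.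

Fact opPQ (v : Kspace) : opP (opQ v) = opQ (opP v).
Proof. by rewrite /opP /opQ !scalerA mulrC. Qed.

End UnderlyingSpace.

Definition is_Kbasis (K : fieldType) (V : lmodType (Kxy K)) (n : nat)
    (e : n.-tuple V) : Prop :=
  forall u : Kspace V, exists! c : 'rV[K]_n,
    u = \sum_(i < n) c 0 i *: (tnth e i : Kspace V).

HB.mixin Record Lmodule_isLieAlgebra (K : fieldType) L of GRing.Lmodule K L := {
  lie : L -> L -> L;
  lie_linearl : forall z, linear (lie^~ z);
  lie_linearr : forall x, linear (lie x);
  lie_alternating : forall x, lie x x = 0;
  lie_jacobi : forall x y z,
    lie x (lie y z) + lie y (lie z x) + lie z (lie x y) = 0
}.

#[short(type="lieAlgType")]
HB.structure Definition LieAlgebra (K : fieldType) :=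
  { L of Lmodule_isLieAlgebra K L & GRing.Lmodule K L }.

Definition lie_isomorphic (K : fieldType) (L M : lieAlgType K) : Prop :=
  exists f : {linear L -> M}, bijective f /\ {morph f : x y / lie x y}.

(* The element ((a, b), v) of assoc_lie V stands for a P + b Q + v, where P and
   Q are formal basis vectors: they stay independent even when the operators
   opP and opQ are not. *)
Section AssociatedLieAlgebra.
Variables (K : fieldType) (V : lmodType (Kxy K)).

Definition assoc_lie : Type := ((K^o * K^o) * Kspace V)%type.

HB.instance Definition _ := GRing.Lmodule.copy assoc_lie
  ((K^o * K^o) * Kspace V)%type.

Definition PQ_act (t : K^o * K^o) (v : Kspace V) : Kspace V :=
  (t.1 : K) *: opP v + (t.2 : K) *: opQ v.

Definition assoc_bracket (u w : assoc_lie) : assoc_lie :=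
  (0, PQ_act u.1 w.2 - PQ_act w.1 u.2).

Fact PQ_act_linearr t : linear (PQ_act t).
Proof.
move=> c u v; rewrite /PQ_act (linearP (@opP K V)) (linearP (@opQ K V)).
by rewrite !scalerDr addrACA !scalerA ![c * _]mulrC.
Qed.

Fact PQ_act_linearl v : linear (PQ_act^~ v).
Proof.
by move=> c t s; rewrite /PQ_act /= !scalerDl !scalerDr addrACA !scalerA.
Qed.

HB.instance Definition _ t := GRing.isLinear.Build K _ _ *:%R (PQ_act t)
  (PQ_act_linearr t).

Fact PQ_actC t s v : PQ_act t (PQ_act s v) = PQ_act s (PQ_act t v).
Proof.
rewrite /PQ_act !(linearD (@opP K V)) !(linearD (@opQ K V)).
rewrite !(linearZZ (@opP K V)) !(linearZZ (@opQ K V)) !scalerDr !scalerA /= !opPQ.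
rewrite !(mulrC (t.1 : K)) !(mulrC (t.2 : K)) -!addrA; congr (_ + _).
by rewrite addrCA.
Qed.

Fact PQ_act0 v : PQ_act 0 v = 0.
Proof. by rewrite /PQ_act !scale0r addr0. Qed.

Fact assoc_linearr x : linear (assoc_bracket x).
Proof.
move=> c u w; congr (_, _); first by rewrite /= scaler0 addr0.
by rewrite /= PQ_act_linearr PQ_act_linearl scalerBr opprD addrACA.
Qed.

Fact assoc_linearl z : linear (assoc_bracket^~ z).
Proof.
move=> c u w; congr (_, _); first by rewrite /= scaler0 addr0.
by rewrite /= PQ_act_linearr PQ_act_linearl scalerBr opprD addrACA.
Qed.

Fact assoc_alternating x : assoc_bracket x x = 0.
Proof. by rewrite /assoc_bracket subrr. Qed.

Fact assoc_jacobi x y z :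
  assoc_bracket x (assoc_bracket y z) + assoc_bracket y (assoc_bracket z x)
  + assoc_bracket z (assoc_bracket x y) = 0.
Proof.
congr (_, _); first by rewrite /= !addr0.
rewrite /= !PQ_act0 !subr0 !linearB /=.
rewrite (PQ_actC z.1 x.1) (PQ_actC y.1 x.1) (PQ_actC z.1 y.1).
by rewrite [X in X + _]addrC subrKA subrKA subrr.
Qed.

HB.instance Definition _ := Lmodule_isLieAlgebra.Build K assoc_lie
  assoc_linearl assoc_linearr assoc_alternating assoc_jacobi.

End AssociatedLieAlgebra.

Definition is_linear_aut (K : fieldType)
    (theta : {lrmorphism Kxy K -> Kxy K}) : Prop :=
  bijective theta /\
  exists2 alpha : 'M[K]_2, alpha \in unitmx &
    theta (px K) = alpha 0 0 *: px K + alpha 0 1 *: py K /\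
    theta (py K) = alpha 1 0 *: px K + alpha 1 1 *: py K.

(* theta only serves to select the K[x,y]-module structure put on the carrier. *)
Definition twisted (K : fieldType) (theta : {lrmorphism Kxy K -> Kxy K})
  (V : lmodType (Kxy K)) : Type := V.

Section Twist.
Variables (K : fieldType) (theta : {lrmorphism Kxy K -> Kxy K}).
Variable V : lmodType (Kxy K).

Local Notation twist := (twisted theta V).

HB.instance Definition _ := GRing.Zmodule.copy twist V.

Definition twist_scale (p : Kxy K) (v : twist) : twist := theta p *: (v : V).

Fact twist_scaleA p q v :
  twist_scale p (twist_scale q v) = twist_scale (p * q) v.
Proof. by rewrite /twist_scale scalerA rmorphM. Qed.

Fact twist_scale1 : left_id 1 twist_scale.
Proof. by move=> v; rewrite /twist_scale rmorph1 scale1r. Qed.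

Fact twist_scaleDr : right_distributive twist_scale +%R.
Proof. by move=> p u v; rewrite /twist_scale scalerDr. Qed.

Fact twist_scaleDl v : {morph twist_scale^~ v : p q / p + q}.
Proof. by move=> p q; rewrite /twist_scale rmorphD scalerDl. Qed.

HB.instance Definition _ := GRing.Zmodule_isLmodule.Build (Kxy K) twist
  twist_scaleA twist_scale1 twist_scaleDr twist_scaleDl.

End Twist.

Definition module_isomorphic (R : nzRingType) (V W : lmodType R) : Prop :=
  exists f : {linear V -> W}, bijective f.

(* Equality of modules is equality of the bundled structures: same carrier and
   same operations. *)
Definition weakly_isomorphic (K : fieldType) (V W : lmodType (Kxy K)) : Prop :=
  exists (k : nat) (M : nat -> lmodType (Kxy K)),
    [/\ M 0%N = V, M k = W &
      forall i : nat, (i < k)%N ->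
        module_isomorphic (M i) (M i.+1) \/
        exists2 theta : {lrmorphism Kxy K -> Kxy K},
          is_linear_aut theta & M i.+1 = twisted theta (M i)].

(* Main.v *)
(* A nonzero linear form in x and y that annihilates the module is preserved by
   isomorphism, and a linear automorphism sends it to another such form.  On V
   the form y is zero, while a x + b y maps w1 to a b1 + b b2, which vanishes
   only if a = b = 0; so V and W are not weakly isomorphic.  The Lie algebras
   are isomorphic because in L_W the operators ad w1, ad w2 act on the span of
   P, Q, b1, b2 as, up to sign, P, Q act on V: send P |-> w1, Q |-> w2,
   v1 |-> -P, v2 |-> -Q, a1 |-> b1, a2 |-> b2. *)
Require Import Defs.
From HB Require Import structures.
From mathcomp Require Import all_boot all_order all_algebra.
From mathcomp Require Import mpoly.
Import GRing.Theory.
Local Open Scope ring_scope.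

Section AnnihilatingForm.
Variable K : fieldType.

(** Coefficients form a row vector, so that a linear automorphism acts on them by right
    multiplication with its matrix. *)
Definition linform (c : 'rV[K]_2) : {mpoly K[2]} :=
  c 0 0 *: px K + c 0 1 *: py K.

Lemma scale_linform (V : lmodType {mpoly K[2]}) (c : 'rV[K]_2)
    (u : Kspace V) :
  linform c *: (u : V) = c 0 0 *: opP u + c 0 1 *: opQ u.
Proof. by rewrite /linform -!mul_mpolyC scalerDl -!scalerA. Qed.

Definition killed_by_linform (V : lmodType {mpoly K[2]}) : Prop :=
  exists2 c : 'rV[K]_2, c != 0 & forall u : V, linform c *: u = 0.

Lemma module_isomorphic_killed (V W : lmodType {mpoly K[2]}) :
  module_isomorphic V W -> killed_by_linform V -> killed_by_linform W.
Proof.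
case=> f [g _ gK] [c c0 cV]; exists c => // w.
by rewrite -(gK w) -linearZ cV linear0.
Qed.

(** If [theta] has matrix [A], the form with coefficients [c *m invmx A] acts on the twist as the
    form [c] acts on [V], and it is nonzero because [A] is invertible. *)
Lemma twisted_killed (theta : {lrmorphism {mpoly K[2]} -> {mpoly K[2]}})
    (V : lmodType {mpoly K[2]}) :
  is_linear_aut theta -> killed_by_linform V ->
  killed_by_linform (twisted theta V).
Proof.
case=> _ [A Aunit [thetax thetay]] [c c0 cV].
have thetaE d : theta (linform d) = linform (d *m A).
  have lift01 : lift ord0 ord0 = 1 :> 'I_2 by apply: val_inj.
  rewrite /linform linearD !linearZ /= thetax thetay !mxE.
  rewrite !big_ord_recl !big_ord0.
  by rewrite !addr0 lift01 !scalerDr !scalerDl !scalerA addrACA.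
exists (c *m invmx A) => [|u].
  apply: contraNneq c0 => cA0.
  by rewrite -[c](mulmxKV Aunit) cA0 mul0mx.
(* A scalar [p] acts on the twist as [theta p] by definition, so the two sides become
   convertible. *)
by rewrite -(cV u) -[in RHS](mulmxKV Aunit c) -thetaE.
Qed.

Lemma weakly_isomorphic_killed (V W : lmodType {mpoly K[2]}) :
  weakly_isomorphic V W -> killed_by_linform V -> killed_by_linform W.
Proof.
case=> k [M [<- <- step]] kM0; elim: k step => // k IHk step.
have kMk : killed_by_linform (M k).
  by apply: IHk => i /ltnW ik; apply: step.
case: (step k (ltnSn k)) => [isoM|[theta theta_aut ->]].
  exact: module_isomorphic_killed _ _ isoM kMk.
exact: twisted_killed _ _ theta_aut kMk.
Qed.

End AnnihilatingForm.

(** The basis property makes the linear map [comb] from coordinates to vectors bijective; the dual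
    forms are the components of its inverse. *)
Lemma dual_basis (K : fieldType) (V : lmodType {mpoly K[2]}) (n : nat)
    (e : n.-tuple V) :
  is_Kbasis e ->
  exists k : 'I_n -> {linear Kspace V -> K^o},
    (forall u, u = \sum_(i < n) (k i u : K) *: (tnth e i : Kspace V)) /\
    (forall i j, k i (tnth e j) = (i == j)%:R).
Proof.
move=> e_basis.
pose comb (c : 'rV[K]_n) : Kspace V :=
  \sum_(i < n) c 0 i *: (tnth e i : Kspace V).
(* Boolean equality makes the predicate decidable, so [xchoose] can select the coordinates. *)
have comb_onto u : exists c, u == comb c.
  by have [c [/eqP uc _]] := e_basis u; exists c.
pose g u := xchoose (comb_onto u).
have gK u : comb (g u) = u by apply/esym/eqP/(xchooseP (comb_onto u)).
have combK c : g (comb c) = c.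
  have [d [_ uniq_d]] := e_basis (comb c).
  exact: etrans (esym (uniq_d _ (esym (gK _)))) (uniq_d _ erefl).
have comb_linear : linear comb.
  move=> a c d; rewrite /comb scaler_sumr -big_split /=.
  by apply: eq_bigr => i _; rewrite !mxE scalerDl scalerA.
pose k i (u : Kspace V) : K^o := g u 0 i.
have k_linear i : linear (k i).
  by move=> a u v; rewrite /k -{1}(gK u) -{1}(gK v) -comb_linear combK !mxE.
exists (fun i => HB.pack_for {linear Kspace V -> K^o} (k i)
  (GRing.isLinear.Build K (Kspace V) K^o *:%R (k i) (k_linear i))).
split=> [u|i j] /=; rewrite /k; first by rewrite -[LHS]gK.
suff -> : tnth e j = comb (delta_mx 0 j) by rewrite combK mxE.
rewrite /comb (bigD1 j) //= mxE !eqxx scale1r big1 ?addr0 // => l lj.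
by rewrite mxE (negPf lj) scale0r.
Qed.

Lemma dual_basis4 (K : fieldType) (V : lmodType {mpoly K[2]})
    (e1 e2 e3 e4 : Kspace V) :
  is_Kbasis [tuple (e1 : V); (e2 : V); (e3 : V); (e4 : V)] ->
  exists k1 k2 k3 k4 : {linear Kspace V -> K^o},
    [/\ forall u, u = (k1 u : K) *: e1 + (k2 u : K) *: e2
                      + (k3 u : K) *: e3 + (k4 u : K) *: e4,
        [/\ k1 e1 = 1, k1 e2 = 0, k1 e3 = 0 & k1 e4 = 0],
        [/\ k2 e1 = 0, k2 e2 = 1, k2 e3 = 0 & k2 e4 = 0],
        [/\ k3 e1 = 0, k3 e2 = 0, k3 e3 = 1 & k3 e4 = 0] &
        [/\ k4 e1 = 0, k4 e2 = 0, k4 e3 = 0 & k4 e4 = 1]].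
Proof.
move=> /dual_basis[k [kE kd]].
exists (k (inord 0)), (k (inord 1)), (k (inord 2)), (k (inord 3)).
(* Natural-number indices let both the basis vector and the Kronecker delta compute. *)
have kd' i j : (i < 4)%N -> (j < 4)%N ->
    k (inord i) [:: e1; e2; e3; e4]`_j = (i == j)%:R.
  move=> i4 j4; have := kd (inord i) (inord j).
  by rewrite (tnth_nth 0) -val_eqE /= !inordK.
split.
- move=> u; rewrite [LHS]kE !big_ord_recl big_ord0 addr0 !addrA.
  by congr (_ *: _ + _ *: _ + _ *: _ + _ *: _); congr (k _ u);
    apply: val_inj; rewrite /= inordK.
- by split; [apply: (kd' 0 0)|apply: (kd' 0 1)|apply: (kd' 0 2)
            |apply: (kd' 0 3)].
- by split; [apply: (kd' 1 0)|apply: (kd' 1 1)|apply: (kd' 1 2)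
            |apply: (kd' 1 3)].
- by split; [apply: (kd' 2 0)|apply: (kd' 2 1)|apply: (kd' 2 2)
            |apply: (kd' 2 3)].
- by split; [apply: (kd' 3 0)|apply: (kd' 3 1)|apply: (kd' 3 2)
            |apply: (kd' 3 3)].
Qed.

Theorem lemma3 (K : closedFieldType) (char0 : [pchar K] =i pred0)
  (V W : lmodType {mpoly K[2]})
  (v1 v2 a1 a2 : V) (w1 w2 b1 b2 : W)
  (basisV : is_Kbasis [tuple v1; v2; a1; a2])
  (basisW : is_Kbasis [tuple w1; w2; b1; b2])
  (xV : [/\ px K *: v1 = a1, px K *: v2 = a2,
            px K *: a1 = 0 & px K *: a2 = 0])
  (yV : [/\ py K *: v1 = 0, py K *: v2 = 0,
            py K *: a1 = 0 & py K *: a2 = 0])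
  (xW : [/\ px K *: w1 = b1, px K *: w2 = 0,
            px K *: b1 = 0 & px K *: b2 = 0])
  (yW : [/\ py K *: w1 = b2, py K *: w2 = 0,
            py K *: b1 = 0 & py K *: b2 = 0]) :
  ~ weakly_isomorphic V W /\ lie_isomorphic (assoc_lie V) (assoc_lie W).
Proof.
have [k1 [k2 [k3 [k4 [kE [k11 k12 k13 k14] [k21 k22 k23 k24]
  [k31 k32 k33 k34] [k41 k42 k43 k44]]]]]] := dual_basis4 _ _ _ _ _ _ basisV.
have [h1 [h2 [h3 [h4 [hE [h11 h12 h13 h14] [h21 h22 h23 h24]
  [h31 h32 h33 h34] [h41 h42 h43 h44]]]]]] := dual_basis4 _ _ _ _ _ _ basisW.
case: xV yV xW yW => [xv1 xv2 xa1 xa2] [yv1 yv2 ya1 ya2]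
  [xw1 xw2 xb1 xb2] [yw1 yw2 yb1 yb2].
have opPV (u : Kspace V) :
    opP u = (k1 u : K) *: (a1 : Kspace V) + (k2 u : K) *: (a2 : Kspace V).
  rewrite {1}[u]kE !linearD !linearZ /= /opP xv1 xv2 xa1 xa2.
  by rewrite !scaler0 !addr0.
have opQV (u : Kspace V) : opQ u = 0.
  rewrite [u]kE !linearD !linearZ /= /opQ yv1 yv2 ya1 ya2.
  by rewrite !scaler0 !addr0.
have opPW (u : Kspace W) : opP u = (h1 u : K) *: (b1 : Kspace W).
  rewrite {1}[u]hE !linearD !linearZ /= /opP xw1 xw2 xb1 xb2.
  by rewrite !scaler0 !addr0.
have opQW (u : Kspace W) : opQ u = (h1 u : K) *: (b2 : Kspace W).
  rewrite {1}[u]hE !linearD !linearZ /= /opQ yw1 yw2 yb1 yb2.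
  by rewrite !scaler0 !addr0.
split.
  move=> /weakly_isomorphic_killed[].
    (* The coefficients (0, 1) of the form y. *)
    exists (delta_mx 0 1) => [|u].
      apply/eqP => /rowP/(_ 1)/eqP.
      by rewrite !mxE !eqxx oner_eq0.
    by rewrite scale_linform opQV !mxE scale0r scaler0 addr0.
  move=> c /eqP c0 cW; apply: c0; apply/rowP => i.
  (* Evaluating at [w1] gives c00 b1 + c01 b2 = 0; the dual forms [h3] and [h4] then isolate the two
     coefficients. *)
  have := cW w1; rewrite scale_linform opPW opQW h11 !scale1r => c_w1.
  have c00 : c 0 0 = 0.
    have := congr1 h3 c_w1.
    rewrite linearD !linearZ /= h33 h34 scaler0 addr0 linear0.
    by rewrite /GRing.scale /= mulr1.
  have c01 : c 0 1 = 0.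
    have := congr1 h4 c_w1.
    rewrite linearD !linearZ /= h43 h44 scaler0 add0r linear0.
    by rewrite /GRing.scale /= mulr1.
  rewrite mxE; case: i => [[|[|//]] i2].
    by rewrite -[RHS]c00; congr (c _ _); apply: val_inj.
  by rewrite -[RHS]c01; congr (c _ _); apply: val_inj.
(* The minus signs are forced by antisymmetry: [P, v1] = a1 must go to b1 = [P, w1] = [w1, -P], and
   likewise [P, v2] = a2 to b2 = [w1, -Q]. *)
pose f (z : assoc_lie V) : assoc_lie W :=
  ((- k1 z.2, - k2 z.2),
   (z.1.1 : K) *: (w1 : Kspace W) + (z.1.2 : K) *: (w2 : Kspace W)
   + (k3 z.2 : K) *: (b1 : Kspace W) + (k4 z.2 : K) *: (b2 : Kspace W)).
pose g (z : assoc_lie W) : assoc_lie V :=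
  ((h1 z.2, h2 z.2),
   (- z.1.1 : K) *: (v1 : Kspace V) + (- z.1.2 : K) *: (v2 : Kspace V)
   + (h3 z.2 : K) *: (a1 : Kspace V) + (h4 z.2 : K) *: (a2 : Kspace V)).
(* Dual forms take values in [K^o], so a form evaluated on a multiple of its own basis vector
   appears as a multiple of 1. *)
have scaleK1 (a : K) : a%:A = a :> K^o by exact: mulr1.
have f_linear : linear f.
  move=> c [[p q] u] [[r s] v]; rewrite /f /=; congr ((_, _), _).
  - by rewrite linearP /= opprD scalerN.
  - by rewrite linearP /= opprD scalerN.
  - rewrite /= !linearP /= !scalerDl -!scalerA !scalerDr.
    rewrite [RHS]addrACA; congr (_ + _).
    rewrite [RHS]addrACA; congr (_ + _).
    by rewrite [RHS]addrACA.
have fK : cancel f g.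
  move=> [[p q] u]; rewrite /f /g /=.
  rewrite !linearD !linearZ /= h11 h12 h13 h14 h21 h22 h23 h24.
  rewrite h31 h32 h33 h34 h41 h42 h43 h44 !scaler0 !addr0 !add0r !opprK.
  by rewrite !scaleK1 -kE.
have gK : cancel g f.
  move=> [[p q] u]; rewrite /f /g /=.
  rewrite !linearD !linearZ /= k11 k12 k13 k14 k21 k22 k23 k24.
  rewrite k31 k32 k33 k34 k41 k42 k43 k44 oppr0 !scaler0 !addr0.
  rewrite !add0r.
  by rewrite !scalerN !scaleNr !opprK !scaleK1 -hE.
exists (HB.pack_for {linear assoc_lie V -> assoc_lie W} f
  (GRing.isLinear.Build K (assoc_lie V) (assoc_lie W) *:%R f f_linear)).
split; first by exists g.
(* Both sides reduce to (p k1(v) - r k1(u)) b1 + (p k2(v) - r k2(u)) b2, with zero component along P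
   and Q since [k1] and [k2] vanish on [a1] and [a2]. *)
move=> [[p q] u] [[r s] v]; rewrite /= /f /lie /= /assoc_bracket /PQ_act /=.
rewrite !opPV !opQV !opPW !opQW.
rewrite !scaler0 !addr0 !linearB !linearZ !linearD !linearZ /=.
rewrite k13 k14 k23 k24 k33 k34 k43 k44 h11 h12 h13 h14.
rewrite !(scalerN, scaleNr, scaler0, scale0r, oppr0, scaleK1, addr0,
  add0r, opprK).
congr (_, _); rewrite /= !scalerA addrACA -!scaleNr -!scalerDl.
by congr (_ *: _ + _ *: _); rewrite scaleNr; apply: addrC.
Qed.
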